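(* Let $k$ be a field, $P=k[x_1,\ldots,x_n]$, $\mathcal F=(f_1,\ldots,f_m)\in P^m$ and $I=(f_1,\ldots,f_m)$, with orderings and notation as fixed in the context. Every $\mathcal S$-Gröbner basis of $I$ contains a finite $\mathcal S$-Gröbner basis of $I$.
   Context: Let $k$ be a field, $k^*=k\setminus\{0\}$, $P=k[x_1,\ldots,x_n]$, and let $\mathbb T^n$ be the monoid of power products of $x_1,\ldots,x_n$ with a fixed admissible term ordering $\mu$ (a total order $<$ compatible with multiplication with $1$ as least element). Let $P^m$ be the free $P$-module with basis $e_1,\ldots,e_m$ and $\mathbb T^n_m=\{te_\ell\mid t\in\mathbb T^n,\ 1\le \ell\le m\}$ its set of module terms, with a fixed module term ordering $\mu'$ (a total order $<$ with $\sigma<\sigma'\Rightarrow t\sigma<t\sigma'$ and $\sigma\le t\sigma$ for all $t\in\mathbb T^n$, $\sigma,\sigma'\in\mathbb T^n_m$) that is compatible with $\mu$: $t<u$ implies $te_i<ue_i$ for all $i$. $\mathrm{LT}(\cdot)$ denotes leading terms with respect to $\mu$ in $P$ and with respect to $\mu'$ in $P^m$. By convention $\mathrm{LT}(0)$ is smaller than every term. Fix $\mathcal F=(f_1,\ldots,f_m)\in P^m$, $I=(f_1,\ldots,f_m)\subseteq P$, and let $v:P^m\to I$ be the $P$-linear map with $v(e_i)=f_i$. Put $\mathrm{Syz}\,\mathcal F=\ker v$, $\mathrm{LT}(\mathrm{Syz}\,\mathcal F)\subseteq\mathbb T^n_m$ the set of leading module terms of its nonzero elements, and $\mathrm{NS}(\mathrm{Syz}\,\mathcal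 F)=\mathbb T^n_m\setminus \mathrm{LT}(\mathrm{Syz}\,\mathcal F)$. For $f\in I\setminus\{0\}$, $\mathcal S(f)\in \mathrm{NS}(\mathrm{Syz}\,\mathcal F)$ is the leading module term (w.r.t. $\mu'$) of the normal form modulo $\mathrm{Syz}\,\mathcal F$ of any $p\in P^m$ with $v(p)=f$, i.e. of the unique preimage of $f$ under $v$ all of whose module terms lie in $\mathrm{NS}(\mathrm{Syz}\,\mathcal F)$. A nonzero $f\in I$ is $\mathcal S$-irreducible if there are no $h\in I\setminus\{0\}$, $t\in\mathbb T^n$, $\alpha\in k^*$ with $\mathrm{LT}(f-\alpha th)<\mathrm{LT}(f)$ and $\mathcal S(th)<\mathcal S(f)$. A set $G\subset I$ is an $\mathcal S$-Gröbner basis (of $I$) if for each $\mathcal S$-irreducible $f\in I\setminus\{0\}$ there exist a nonzero $g\in G$ and $t\in\mathbb T^n$ such that $\mathrm{LT}(tg)=\mathrm{LT}(f)$ and $\mathcal S(tg)=\mathcal S(f)$. *)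

(* Defs.v *)
From mathcomp Require Import all_boot all_order all_algebra.
From mathcomp Require Import mpoly.
From Stdlib Require Import ClassicalEpsilon.

Set Implicit Arguments.
Unset Strict Implicit.
Unset Printing Implicit Defensive.

Import GRing.Theory.

Local Open Scope ring_scope.

(* Orders are given by their strict part.                                   *)
Record strict_total_order (T : eqType) (lt : rel T) : Prop := StrictTotalOrder {
  sto_irr : irreflexive lt;
  sto_trans : transitive lt;
  sto_total : forall a b : T, a != b -> lt a b || lt b a
}.

(* Power products are identified with their exponents ['X_{1..n}], so that  *)
(* multiplication of terms is [(t + u)%MM] and the term 1 is [0%MM].        *)
Record term_order (n : nat) (lt : rel 'X_{1..n}) : Prop := TermOrder {
  to_order : strict_total_order lt;
  to_mul : forall w t u : 'X_{1..n}, lt t u -> lt (w + t)%MM (w + u)%MM;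
  to_least : forall t : 'X_{1..n}, t != 0%MM -> lt 0%MM t
}.

(* The pair [(t, l)] is the module term t e_l.                              *)
Notation mterm n m := ('X_{1..n} * 'I_m)%type.

Definition mt_mul (n m : nat) (t : 'X_{1..n}) (s : mterm n m) : mterm n m :=
  ((t + s.1)%MM, s.2).

Record mterm_order (n m : nat) (ltm : rel (mterm n m)) : Prop := MTermOrder {
  mto_order : strict_total_order ltm;
  mto_mul : forall (t : 'X_{1..n}) (s s' : mterm n m),
    ltm s s' -> ltm (mt_mul t s) (mt_mul t s');
  mto_le : forall (t : 'X_{1..n}) (s : mterm n m),
    (s == mt_mul t s) || ltm s (mt_mul t s)
}.

Definition compatible_orders (n m : nat) (lt : rel 'X_{1..n})
    (ltm : rel (mterm n m)) : Prop :=
  forall (t u : 'X_{1..n}) (i : 'I_m), lt t u -> ltm (t, i) (u, i).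

(* [None], the leading term of 0, lies below every term.                    *)
Definition olt (T : Type) (lt : rel T) (a b : option T) : bool :=
  match a, b with
  | Some x, Some y => lt x y
  | None, Some _ => true
  | _, None => false
  end.

Definition omax (T : Type) (lt : rel T) (a b : option T) : option T :=
  if olt lt a b then b else a.

Definition lead (T : Type) (lt : rel T) (s : seq T) : option T :=
  foldr (fun x a => omax lt (Some x) a) None s.

Definition LT (k : fieldType) (n : nat) (lt : rel 'X_{1..n})
    (f : {mpoly k[n]}) : option 'X_{1..n} :=
  lead lt (msupp f).

(* The free module P^m is ['rV[{mpoly k[n]}]_m].                            *)
Definition vsupp (k : fieldType) (n m : nat) (p : 'rV[{mpoly k[n]}]_m) :
    seq (mterm n m) :=
  [seq (t, l) | l <- enum 'I_m, t <- msupp (p 0 l)].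

Definition LTm (k : fieldType) (n m : nat) (ltm : rel (mterm n m))
    (p : 'rV[{mpoly k[n]}]_m) : option (mterm n m) :=
  lead ltm (vsupp p).

Definition vmap (k : fieldType) (n m : nat) (F p : 'rV[{mpoly k[n]}]_m) :
    {mpoly k[n]} :=
  \sum_(l < m) p 0 l * F 0 l.

Definition in_ideal (k : fieldType) (n m : nat) (F : 'rV[{mpoly k[n]}]_m)
    (f : {mpoly k[n]}) : Prop :=
  exists p : 'rV[{mpoly k[n]}]_m, f = vmap F p.

Definition Syz (k : fieldType) (n m : nat) (F p : 'rV[{mpoly k[n]}]_m) : Prop :=
  vmap F p = 0.

Definition LT_Syz (k : fieldType) (n m : nat) (ltm : rel (mterm n m))
    (F : 'rV[{mpoly k[n]}]_m) (s : mterm n m) : Prop :=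
  exists p : 'rV[{mpoly k[n]}]_m, [/\ Syz F p, p != 0 & LTm ltm p = Some s].

Definition NS_Syz (k : fieldType) (n m : nat) (ltm : rel (mterm n m))
    (F : 'rV[{mpoly k[n]}]_m) (s : mterm n m) : Prop :=
  ~ LT_Syz ltm F s.

Definition is_nf_preimage (k : fieldType) (n m : nat) (ltm : rel (mterm n m))
    (F : 'rV[{mpoly k[n]}]_m) (f : {mpoly k[n]}) (p : 'rV[{mpoly k[n]}]_m) :
    Prop :=
  vmap F p = f /\ (forall s : mterm n m, s \in vsupp p -> NS_Syz ltm F s).

(* For a module term order [ltm] and f in the ideal, [is_nf_preimage] holds *)
(* of exactly one vector (existence uses that [ltm] is a well-order), and   *)
(* [epsilon] selects it; outside the ideal the value is meaningless.        *)
Definition nf_preimage (k : fieldType) (n m : nat) (ltm : rel (mterm n m))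
    (F : 'rV[{mpoly k[n]}]_m) (f : {mpoly k[n]}) : 'rV[{mpoly k[n]}]_m :=
  epsilon (inhabits 0) (is_nf_preimage ltm F f).

Definition Ssig (k : fieldType) (n m : nat) (ltm : rel (mterm n m))
    (F : 'rV[{mpoly k[n]}]_m) (f : {mpoly k[n]}) : option (mterm n m) :=
  LTm ltm (nf_preimage ltm F f).

Definition S_irreducible (k : fieldType) (n m : nat) (lt : rel 'X_{1..n})
    (ltm : rel (mterm n m)) (F : 'rV[{mpoly k[n]}]_m) (f : {mpoly k[n]}) :
    Prop :=
  [/\ in_ideal F f, f != 0 &
    ~ exists (h : {mpoly k[n]}) (t : 'X_{1..n}) (a : k),
        [/\ in_ideal F h, h != 0, a != 0,
            olt lt (LT lt (f - a *: ('X_[t] * h))) (LT lt f)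
          & olt ltm (Ssig ltm F ('X_[t] * h)) (Ssig ltm F f)]].

Definition S_Groebner_basis (k : fieldType) (n m : nat) (lt : rel 'X_{1..n})
    (ltm : rel (mterm n m)) (F : 'rV[{mpoly k[n]}]_m)
    (G : {mpoly k[n]} -> Prop) : Prop :=
  (forall g : {mpoly k[n]}, G g -> in_ideal F g) /\
  (forall f : {mpoly k[n]}, S_irreducible lt ltm F f ->
    exists (g : {mpoly k[n]}) (t : 'X_{1..n}),
      [/\ G g, g != 0, LT lt ('X_[t] * g) = LT lt f
        & Ssig ltm F ('X_[t] * g) = Ssig ltm F f]).

(* Main.v *)
Require Import Defs.
From mathcomp Require Import all_boot all_order all_algebra.
From mathcomp Require Import mpoly.
From Stdlib Require Import Classical ClassicalEpsilon.

(** Attach to every nonzero f in I the pair (LT f, S f), where S is [Ssig].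
    Dickson's lemma, applied to these pairs with the two components divided
    independently, gives finitely many multiples h = t' g' (g' in G) such that,
    for each multiple t g of an element of G, some h has
        LT (t g) = u LT h   and   S (t g) = w S h
    for power products u and w which need not agree.  The g' that occur form the
    finite basis.  Let f be S-irreducible; as G is a basis, f shares both its
    invariants with some t g, hence LT f = u LT h and S f = w S h.

    - If u = w, the multiple (u t') g' has the leading term and the signature
      of f: u S h = S f lies outside LT(Syz F), so that S (u h) = u S h
      ([Ssig_mulX]).
    - If u < w, then u h has the leading term of f and, the two orders being
      compatible, a signature at most
      u S h < w S h = S f ([Ssig_mulX_le]); so f is reducible
      ([S_irreducible_min]).
    - If w < u, then w h has the signature of f and a smaller leading term;
      subtracting a multiple of w h from f keeps the leading term and lowers
      the signature, which reduces to the preceding contradiction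
      ([S_irreducible_LT_min]).

    Applying Dickson's lemma to the multiples t g instead of the elements of G
    themselves matters: S (t g) may be smaller than t S g, in which case the
    signature of f need not be a multiple of S g.

    The facts about S rest on normal forms modulo Syz F: they exist because a
    module term order is well-founded (Dickson's lemma again), and they are
    unique, which makes S f the least leading module term among the preimages
    of f ([Ssig_le]).  *)

Set Implicit Arguments.
Unset Strict Implicit.
Unset Printing Implicit Defensive.

Import GRing.Theory.

Local Open Scope ring_scope.

(** * Dickson's lemma *)

(** Divisibility of power products and of module terms is the componentwise
    comparison of finitely many natural numbers.  Recording these numbers as a
    list of functions on an arbitrary type gives one lemma for terms, module
    terms and pairs of both, by induction on the list. *)
Definition divides_under (T : Type) (fs : seq (T -> nat)) (b a : T) : bool :=
  all (fun f : T -> nat => (f b <= f a)%N) fs.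

(** A basis s for fs alone also serves for f :: fs, except for those a whose
    value f a is below some f b with b in s.  These values are bounded, so they
    split the exceptions into finitely many slices on which f is constant. *)
Lemma dickson (T : eqType) (fs : seq (T -> nat)) (P : T -> Prop) :
  exists s : seq T, (forall b, b \in s -> P b) /\
    (forall a, P a -> exists2 b, b \in s & divides_under fs b a).
Proof.
elim: fs P => [|f fs IH] P.
  case: (classic (exists a, P a)) => [[a Pa]|noP].
    by exists [:: a]; split=> [b /[!inE]/eqP->|b _] //; exists a; rewrite ?inE.
  by exists [::]; split=> // a Pa; case: noP; exists a.
have [s [sP sdiv]] := IH P.
have slices N : exists s' : seq T, (forall b, b \in s' -> P b) /\
    (forall a, P a -> (f a < N)%N ->
       exists2 b, b \in s' & divides_under (f :: fs) b a).
  elim: N => [|N [s' [s'P s'div]]]; first by exists [::].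
  have [s2 [s2P s2div]] := IH (fun a => P a /\ f a = N).
  exists (s' ++ s2); split=> [b|a Pa].
    by rewrite mem_cat => /orP[/s'P|/s2P[]].
  rewrite ltnS leq_eqVlt => /orP[/eqP fa|/(s'div a Pa)[b bs' ba]].
    have [b bs2 ba] := s2div a (conj Pa fa).
    exists b; first by rewrite mem_cat bs2 orbT.
    by rewrite /divides_under /= (s2P b bs2).2 fa leqnn.
  by exists b; rewrite // mem_cat bs'.
have [s' [s'P s'div]] := slices (\max_(b <- s) f b).
exists (s ++ s'); split=> [b|a Pa]; first by rewrite mem_cat => /orP[/sP|/s'P].
have [b bs ba] := sdiv a Pa.
have [fba|fab] := leqP (f b) (f a).
  by exists b; [rewrite mem_cat bs | rewrite /divides_under /= fba].
have [|c cs' ca] := s'div a Pa; last by exists c; rewrite // mem_cat cs' orbT.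
by apply: leq_trans fab _; apply: (leq_bigmax_seq b).
Qed.

(** * Leading elements of a list *)

Section StrictTotalOrder.
Variables (T : eqType) (lt : rel T).
Hypothesis ltP : strict_total_order lt.

Lemma sto_asym x y : lt x y -> ~~ lt y x.
Proof.
by move=> xy; apply/negP => /(sto_trans ltP xy); rewrite (sto_irr ltP).
Qed.

Lemma sto_flip : strict_total_order (fun x y => lt y x).
Proof.
split=> [x|y x z yx zy|x y]; first exact: sto_irr.
  exact: (sto_trans ltP zy yx).
by rewrite orbC; apply: sto_total.
Qed.

Lemma sto_olt : strict_total_order (olt lt).
Proof.
split=> [[x|]|[y|] [x|] [z|]|[x|] [y|]] //=; first exact: sto_irr.
  exact: sto_trans.
by move=> xy; apply: sto_total => //; apply: contraNneq xy => ->.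
Qed.

Lemma sto_Nlt_trans y x z : ~~ lt y x -> lt y z -> lt x z.
Proof.
have [->//|/(sto_total ltP)/orP[xy _|->//]] := eqVneq x y.
exact: (sto_trans ltP xy).
Qed.

Lemma lead_None s : lead lt s = None -> s = [::].
Proof.
by case: s => //= x s; rewrite /omax; case: (lead lt s) => //= y; case: ifP.
Qed.

Lemma leadP s x :
  lead lt s = Some x <-> x \in s /\ {in s, forall y, ~~ lt x y}.
Proof.
have leadE z : lead lt s = Some z -> z \in s /\ {in s, forall y, ~~ lt z y}.
  elim: s z => //= a s IH z; rewrite /omax.
  case def_y: (lead lt s) => [y|] /=; last first.
    move=> [<-]; rewrite (lead_None def_y); split; first exact: mem_head.
    by move=> b /[!inE]/eqP->; rewrite (sto_irr ltP).
  have [ys ymax] := IH y def_y.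
  case: ifPn => [ay|nay] [<-]; split; rewrite ?inE ?eqxx ?ys ?orbT //.
    by move=> b /[!inE]/predU1P[->|/ymax//]; apply: sto_asym.
  move=> b /[!inE]/predU1P[->|/ymax yb]; first by rewrite (sto_irr ltP).
  by apply: contra nay; apply: contraTT => nay; apply: contra yb; apply: sto_Nlt_trans.
split=> [/leadE//|[xs xmax]].
case def_y: (lead lt s) => [y|]; last by rewrite (lead_None def_y) in xs.
have [ys ymax] := leadE _ def_y; congr Some; apply/eqP.
by apply: contraTT (ymax x xs) => /(sto_total ltP) /[!(negPf (xmax _ ys))] /[!orbF] ->.
Qed.

Lemma olt_lead s x : {in s, forall y, lt y x} -> olt lt (lead lt s) (Some x).
Proof.
by case def_y: (lead lt s) => [y|] //= sx; apply: sx; case/leadP: def_y.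
Qed.

Lemma lead_lt_notin s x : olt lt (lead lt s) (Some x) -> x \notin s.
Proof.
case def_y: (lead lt s) => [y|] /= yx; last by rewrite (lead_None def_y).
by apply/negP; have [_ /(_ x) ymax] := (leadP _ _).1 def_y => /ymax/negP[].
Qed.

(** Applied to the supports of p, q and p - c q: subtracting an element with
    smaller leading term keeps the leading term. *)
Lemma lead_dominate s1 s2 s x :
  lead lt s1 = Some x -> olt lt (lead lt s2) (Some x) ->
  {subset s <= s1 ++ s2} -> x \in s -> lead lt s = Some x.
Proof.
move=> /leadP[_ max1] s2x sub xs; apply/leadP; split=> // y /sub.
rewrite mem_cat => /orP[/max1//|ys2].
case def_z: (lead lt s2) s2x => [z|] /= zx; last by rewrite (lead_None def_z) in ys2.
have [_ /(_ y ys2) zy] := (leadP _ _).1 def_z.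
exact: sto_asym (sto_Nlt_trans zy zx).
Qed.

(** Applied to the supports of p, q and p - c q, when c makes the common leading
    terms of p and q cancel. *)
Lemma lead_cancel s1 s2 s x :
  lead lt s1 = Some x -> lead lt s2 = Some x ->
  {subset s <= s1 ++ s2} -> x \notin s -> olt lt (lead lt s) (Some x).
Proof.
move=> /leadP[_ max1] /leadP[_ max2] sub xs; apply: olt_lead => y ys.
have: y != x by apply: contraNneq xs => <-.
move=> /(sto_total ltP); suff /negPf->: ~~ lt x y by rewrite orbF.
by have := sub y ys; rewrite mem_cat => /orP[/max1|/max2].
Qed.

End StrictTotalOrder.

Lemma divides_under_comp (T U : Type) (phi : T -> U) (fs : seq (U -> nat)) b a :
  divides_under [seq f \o phi | f <- fs] b a = divides_under fs (phi b) (phi a).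
Proof. by rewrite /divides_under all_map. Qed.

(** * Divisibility and well-foundedness of module terms *)

Section Terms.
Variables (n m : nat).

Definition mnm_coords : seq ('X_{1..n} -> nat) :=
  [seq (fun t : 'X_{1..n} => t i) | i <- enum 'I_n].

(** The index l must not change under divisibility; the two inequalities on l
    and m - l express that it is constant. *)
Definition mterm_coords : seq (mterm n m -> nat) :=
  [:: fun s => val s.2, fun s => (m - val s.2)%N &
      [seq f \o fst | f <- mnm_coords]].

Lemma mnm_coordsP b a :
  divides_under mnm_coords b a -> exists u, a = (u + b)%MM.
Proof.
rewrite /divides_under all_map => /allP ba; exists (a - b)%MM.
by apply/mnmP => i; rewrite mnmDE mnmBE subnK //; apply: (ba i); rewrite mem_enum.
Qed.

Lemma mterm_coordsP b a :
  divides_under mterm_coords b a -> exists w, a = mt_mul w b.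
Proof.
case: b a => [b j] [a i] /and3P[/= ji ij].
move=> ba; have := ba : divides_under [seq f \o fst | f <- mnm_coords] (b, j) (a, i).
rewrite divides_under_comp => /mnm_coordsP[w /= ->].
exists w; congr pair; apply/val_inj/eqP; rewrite eqn_leq ji andbT.
by move: ij; rewrite leq_sub2lE // ltnW.
Qed.

(** A module term order is a well-order: the set Q has a finite basis for
    divisibility, and a multiple of a term is never smaller than that term, so
    the least basis element is the least element of Q. *)
Lemma mterm_minimal (ltm : rel (mterm n m)) (Q : mterm n m -> Prop) s :
  mterm_order ltm -> Q s ->
  exists2 x, Q x & forall y, ltm y x -> ~ Q y.
Proof.
move=> ltmP Qs; have ltmo := mto_order ltmP.
have [B [BQ Bdiv]] := dickson mterm_coords Q.
have flipo := sto_flip ltmo.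
have [b bB _] := Bdiv s Qs.
case def_x: (lead (fun x y => ltm y x) B) => [x|]; last first.
  by rewrite (lead_None def_x) in bB.
have [xB xmin] := (leadP flipo _ _).1 def_x.
exists x => [|y yx /Bdiv[c cB /mterm_coordsP[w y_eq]]]; first exact: BQ.
have cy : ~~ ltm y c.
  rewrite y_eq; case/predU1P: (mto_le ltmP w c) => [<-|/(sto_asym ltmo)//].
  by rewrite (sto_irr ltmo).
by case/negP: (xmin c cB); apply: (sto_Nlt_trans ltmo) yx.
Qed.

End Terms.

(** * Supports and leading terms of polynomials and vectors *)

Section Supports.
Variables (k : fieldType) (n m : nat).
Implicit Types (p q : 'rV[{mpoly k[n]}]_m) (s : mterm n m).

Lemma mem_vsupp p s : (s \in vsupp p) = ((p 0 s.2)@_s.1 != 0).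
Proof.
case: s => t l /=; rewrite -mcoeff_msupp; apply/allpairsPdep/idP => [|tp].
  by case=> l' [t' [_ tp [-> ->]]].
by exists l, t; rewrite mem_enum.
Qed.

Lemma vsupp_nil p : vsupp p = [::] -> p = 0.
Proof.
move=> p0; apply/rowP => l; apply/mpolyP => t; rewrite mxE mcoeff0.
by apply/eqP; move: (mem_vsupp p (t, l)); rewrite p0 => /esym/negbFE.
Qed.

Lemma vsupp_subr p q c : {subset vsupp (p - c%:MP *: q) <= vsupp p ++ vsupp q}.
Proof.
move=> s; rewrite mem_cat !mem_vsupp !mxE mcoeffB mcoeffCM -negb_and.
by apply: contra => /andP[/eqP-> /eqP->]; rewrite mulr0 subr0.
Qed.

Lemma msupp_subr (f h : {mpoly k[n]}) c :
  {subset msupp (f - c *: h) <= msupp f ++ msupp h}.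
Proof.
move=> t; rewrite mem_cat !mcoeff_msupp mcoeffB mcoeffZ -negb_and.
by apply: contra => /andP[/eqP-> /eqP->]; rewrite mulr0 subr0.
Qed.

Lemma LT_mulX (lt : rel 'X_{1..n}) (t u : 'X_{1..n}) (h : {mpoly k[n]}) :
  term_order lt -> LT lt h = Some u -> LT lt ('X_[t] * h) = Some (t + u)%MM.
Proof.
move=> ltP; have lto := to_order ltP; rewrite mulrC.
move=> /(leadP lto)[uh umax]; apply/(leadP lto).
split=> [|y]; rewrite (perm_mem (msuppMX _ _)); first exact: map_f.
move=> /mapP[u' u'h ->]; have [->|] := eqVneq u u'; first by rewrite (sto_irr lto).
move=> /(sto_total lto); rewrite (negPf (umax _ u'h)) /= => /(to_mul ltP t).
exact: sto_asym.
Qed.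

Lemma LTm_mulX (ltm : rel (mterm n m)) (t : 'X_{1..n}) s p :
  mterm_order ltm -> LTm ltm p = Some s ->
  LTm ltm ('X_[t] *: p) = Some (mt_mul t s).
Proof.
move=> ltmP; have lto := mto_order ltmP.
have coefE s' : s' \in vsupp ('X_[t] *: p) ->
    exists2 s0, s0 \in vsupp p & s' = mt_mul t s0.
  rewrite mem_vsupp !mxE mulrC -mcoeff_msupp (perm_mem (msuppMX _ _)).
  case: s' => t' l /= /mapP[u up ->]; exists (u, l) => //.
  by rewrite mem_vsupp /= -mcoeff_msupp.
move=> /(leadP lto)[sp smax]; apply/(leadP lto); split=> [|y /coefE[s' s'p ->]].
  rewrite mem_vsupp !mxE mulrC -mcoeff_msupp (perm_mem (msuppMX _ _)).
  by apply: map_f; rewrite mcoeff_msupp -mem_vsupp.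
have [->|] := eqVneq s s'; first by rewrite (sto_irr lto).
move=> /(sto_total lto); rewrite (negPf (smax _ s'p)) /= => /(mto_mul ltmP t).
exact: sto_asym.
Qed.

Lemma LTm_cancel (ltm : rel (mterm n m)) s p q :
  mterm_order ltm -> LTm ltm p = Some s -> LTm ltm q = Some s ->
  exists2 c : k, c != 0 & olt ltm (LTm ltm (p - c%:MP *: q)) (Some s).
Proof.
move=> ltmP ps qs; have lto := mto_order ltmP.
have [sp _] := (leadP lto _ _).1 ps; have [sq _] := (leadP lto _ _).1 qs.
rewrite !mem_vsupp in sp sq.
exists ((p 0 s.2)@_s.1 / (q 0 s.2)@_s.1); first by rewrite mulf_neq0 ?invr_eq0.
apply: (lead_cancel lto ps qs (@vsupp_subr _ _ _)).
by rewrite mem_vsupp !mxE mcoeffB mcoeffCM divfK // subrr eqxx.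
Qed.

Lemma LT_cancel (lt : rel 'X_{1..n}) t (f h : {mpoly k[n]}) :
  term_order lt -> LT lt f = Some t -> LT lt h = Some t ->
  exists2 c : k, c != 0 & olt lt (LT lt (f - c *: h)) (Some t).
Proof.
move=> ltP ft ht; have lto := to_order ltP.
have [tf _] := (leadP lto _ _).1 ft; have [th _] := (leadP lto _ _).1 ht.
rewrite !mcoeff_msupp in tf th.
exists (f@_t / h@_t); first by rewrite mulf_neq0 ?invr_eq0.
apply: (lead_cancel lto ft ht (@msupp_subr _ _ _)).
by rewrite mcoeff_msupp mcoeffB mcoeffZ divfK // subrr eqxx.
Qed.

Lemma LT_Some (lt : rel 'X_{1..n}) (f : {mpoly k[n]}) :
  f != 0 -> exists t, LT lt f = Some t.
Proof.
rewrite -msupp_eq0; case def_t: (LT lt f) => [t|]; first by exists t.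
by rewrite (lead_None def_t).
Qed.

End Supports.

(** * Normal forms modulo syzygies and the signature S *)

Section Signatures.
Variables (k : fieldType) (n m : nat) (ltm : rel (mterm n m)).
Hypothesis ltmP : mterm_order ltm.
Variable F : 'rV[{mpoly k[n]}]_m.
Implicit Types (p q : 'rV[{mpoly k[n]}]_m) (s : mterm n m) (f h : {mpoly k[n]}).

Let ltmo := mto_order ltmP.

Lemma vmapZ c p : vmap F (c *: p) = c * vmap F p.
Proof. by rewrite /vmap mulr_sumr; apply: eq_bigr => l _; rewrite mxE mulrA. Qed.

Lemma vmapB p q : vmap F (p - q) = vmap F p - vmap F q.
Proof. by rewrite /vmap -sumrB; apply: eq_bigr => l _; rewrite !mxE mulrBl. Qed.

Lemma LTm_mterm s : LTm ltm ('X_[k, s.1] *: delta_mx 0 s.2) = Some s.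
Proof.
apply/(leadP ltmo); split=> [|y]; rewrite mem_vsupp !mxE ?eqxx /=.
  by rewrite mulr1 mcoeffX eqxx oner_eq0.
have [e|_] := eqVneq y.2 s.2; last by rewrite mulr0 mcoeff0 eqxx.
rewrite mulr1 mcoeffX; have [e1 _|_] := eqVneq s.1 y.1; last by rewrite eqxx.
by have -> : y = s by [case: y s e e1 => ? ? [? ?] /= -> ->]; rewrite (sto_irr ltmo).
Qed.

Lemma vsupp_mterm s : {subset vsupp ('X_[k, s.1] *: delta_mx 0 s.2) <= [:: s]}.
Proof.
move=> y; rewrite mem_vsupp !mxE eqxx inE -pair_eqE /pair_eq /= andbC.
have [_|_] := eqVneq y.2 s.2; last by rewrite mulr0 mcoeff0 eqxx.
by rewrite mulr1 mcoeffX; have [_|_] := eqVneq s.1 y.1; rewrite ?eqxx. 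
Qed.

(** Division algorithm, as an argument by least counterexample: the leading term
    of p is cancelled by a syzygy if possible, and otherwise split off, then put
    back in front of the normal form of the rest.  The bound on the leading
    term is what gives [Ssig_le]. *)
Lemma normal_form_exists p :
  exists2 q, is_nf_preimage ltm F (vmap F p) q & ~~ olt ltm (LTm ltm p) (LTm ltm q).
Proof.
pose good p := exists2 q, is_nf_preimage ltm F (vmap F p) q &
  ~~ olt ltm (LTm ltm p) (LTm ltm q).
apply: NNPP => bad_p.
have good0 p' : LTm ltm p' = None -> good p'.
  move=> p'0; exists p'; last by rewrite p'0.
  by split=> // s; rewrite (lead_None p'0).
pose bad s := exists2 p', LTm ltm p' = Some s & ~ good p'.
have [s bad_s] : exists s, bad s.
  case def_s: (LTm ltm p) => [s|]; last by case: bad_p; apply: good0.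
  by exists s, p.
have {s bad_s} [s [p' p's bad_p'] smin] := mterm_minimal ltmP bad_s.
have good_lt p2 : olt ltm (LTm ltm p2) (Some s) -> good p2.
  case def_y: (LTm ltm p2) => [y|]; last by move=> _; apply: good0.
  by move=> /smin ys; apply: NNPP => bad2; apply: ys; exists p2.
(* p' has the least leading term s among the vectors for which the claim fails *)
apply: bad_p'.
have [[z [Fz z0 zs]]|NSs] := classic (LT_Syz ltm F s).
  have [c _ lt_s] := LTm_cancel ltmP p's zs.
  have [q [Fq NSq] qle] := good_lt _ lt_s.
  exists q; first by split; rewrite // Fq vmapB vmapZ Fz mulr0 subr0.
  rewrite p's; apply: sto_asym (sto_olt ltmo) _ _ _.
  exact: sto_Nlt_trans (sto_olt ltmo) _ _ _ qle lt_s.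
have [c c0 lt_s] := LTm_cancel ltmP p's (LTm_mterm s).
have [q [Fq NSq] qle] := good_lt _ lt_s.
(* q is a normal form of the remainder p' - c e_s, so q + c e_s is one of p' *)
set e := 'X_[_] *: _ in Fq lt_s qle.
have sub_q y : y \in vsupp (q - (- c)%:MP *: e) -> y \in vsupp q \/ y = s.
  move=> /vsupp_subr; rewrite mem_cat.
  by case/orP=> [|/vsupp_mterm/[!inE]/eqP]; [left|right].
exists (q - (- c)%:MP *: e).
  split=> [|y /sub_q[/NSq//|->//]].
  by rewrite vmapB Fq vmapB !vmapZ mpolyCN mulNr opprK subrK.
rewrite p's; case def_y: (LTm _ _) => [y|] //=.
have [/sub_q[yq|->] _] := (leadP ltmo _ _).1 def_y; last by rewrite (sto_irr ltmo).
apply: sto_asym => //; have := sto_Nlt_trans (sto_olt ltmo) qle lt_s.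
case def_x: (LTm ltm q) => [x|] /=; last by rewrite (lead_None def_x) in yq.
by apply: (sto_Nlt_trans ltmo); have [_ ->] := (leadP ltmo _ _).1 def_x.
Qed.

(** The leading term of p - q would be a leading term of a syzygy occurring in p
    or in q. *)
Lemma normal_form_unique f p q :
  is_nf_preimage ltm F f p -> is_nf_preimage ltm F f q -> p = q.
Proof.
move=> [Fp NSp] [Fq NSq]; apply/eqP; rewrite -subr_eq0; apply/eqP/vsupp_nil.
case def_s: (LTm ltm (p - q)) => [s|]; last exact: lead_None def_s.
have [spq _] := (leadP ltmo _ _).1 def_s.
have LTs : LT_Syz ltm F s.
  exists (p - q); split=> //; first by rewrite /Syz vmapB Fp Fq subrr.
  apply/eqP => pq0; move: spq; rewrite pq0 mem_vsupp mxE mcoeff0 eqxx //.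
move: spq; rewrite -[q]scale1r -mpolyC1 => /vsupp_subr.
by rewrite mem_cat => /orP[/NSp|/NSq].
Qed.

Lemma nf_preimageP f : in_ideal F f -> is_nf_preimage ltm F f (nf_preimage ltm F f).
Proof.
case=> p ->; have [q q_nf _] := normal_form_exists p.
by apply: epsilon_spec; exists q.
Qed.

Lemma in_ideal_vmap p : in_ideal F (vmap F p).
Proof. by exists p. Qed.

Lemma in_idealM g f : in_ideal F f -> in_ideal F (g * f).
Proof. by case=> p ->; rewrite -vmapZ; apply: in_ideal_vmap. Qed.

Lemma in_idealB f h c : in_ideal F f -> in_ideal F h -> in_ideal F (f - c *: h).
Proof.
move=> [p ->] [q ->]; rewrite -mul_mpolyC -vmapZ -vmapB.
exact: in_ideal_vmap.
Qed.

Lemma Ssig_le p : ~~ olt ltm (LTm ltm p) (Ssig ltm F (vmap F p)).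
Proof.
have [q q_nf q_le] := normal_form_exists p.
by rewrite /Ssig (normal_form_unique (nf_preimageP (in_ideal_vmap p)) q_nf).
Qed.

Lemma Ssig_NS f s : in_ideal F f -> Ssig ltm F f = Some s -> NS_Syz ltm F s.
Proof.
by move=> /nf_preimageP[_ NSf] /(leadP ltmo)[/NSf].
Qed.

Lemma Ssig_Some f : in_ideal F f -> f != 0 -> exists s, Ssig ltm F f = Some s.
Proof.
move=> /nf_preimageP[Ff _] f0; case def_s: (Ssig ltm F f) => [s|]; first by exists s.
move: f0; rewrite -Ff (vsupp_nil (lead_None def_s)) /vmap big1 ?eqxx // => l _.
by rewrite mxE mul0r.
Qed.

(** If S were smaller than s, then s would survive as the leading term of the
    syzygy obtained by subtracting the normal form from p. *)
Lemma Ssig_eq p s :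
  NS_Syz ltm F s -> LTm ltm p = Some s -> Ssig ltm F (vmap F p) = Some s.
Proof.
move=> NSs ps; apply/eqP; apply/negPn/negP => neq_s.
have sig_lt : olt ltm (Ssig ltm F (vmap F p)) (Some s).
  have /orP[//|] := sto_total (sto_olt ltmo) neq_s.
  by rewrite -ps (negPf (Ssig_le p)).
set q := nf_preimage ltm F (vmap F p) in sig_lt.
have [Fq NSq] := nf_preimageP (in_ideal_vmap p).
have [sp _] := (leadP ltmo _ _).1 ps.
have diff_s : LTm ltm (p - q) = Some s.
  apply: (lead_dominate ltmo ps sig_lt).
    by rewrite -[q]scale1r -mpolyC1; apply: vsupp_subr.
  have sq : s \notin vsupp q := lead_lt_notin ltmo sig_lt.
  rewrite !mem_vsupp in sp sq *; move: sq => /negPn sq.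
  by rewrite !mxE mcoeffB (eqP sq) subr0.
apply: NSs; exists (p - q); split=> //; first by rewrite /Syz vmapB Fq subrr.
apply/eqP => pq0; move: diff_s; rewrite pq0 => /(leadP ltmo)[].
by rewrite mem_vsupp mxE mcoeff0 eqxx.
Qed.

Lemma Ssig_mulX_le t h s :
  in_ideal F h -> Ssig ltm F h = Some s ->
  ~~ olt ltm (Some (mt_mul t s)) (Ssig ltm F ('X_[t] * h)).
Proof.
move=> /nf_preimageP[Fh _] hs; rewrite -(LTm_mulX t ltmP hs) -{2}Fh -vmapZ.
exact: Ssig_le.
Qed.

Lemma Ssig_mulX t h s :
  in_ideal F h -> Ssig ltm F h = Some s -> NS_Syz ltm F (mt_mul t s) ->
  Ssig ltm F ('X_[t] * h) = Some (mt_mul t s).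
Proof.
move=> /nf_preimageP[Fh _] hs NSts; rewrite -{1}Fh -vmapZ.
exact: Ssig_eq (LTm_mulX t ltmP hs).
Qed.

Lemma Ssig_cancel f h s :
  in_ideal F f -> in_ideal F h -> Ssig ltm F f = Some s -> Ssig ltm F h = Some s ->
  exists2 c : k, c != 0 & olt ltm (Ssig ltm F (f - c *: h)) (Some s).
Proof.
move=> /nf_preimageP[Ff _] /nf_preimageP[Fh _] fs hs.
have [c c0 lt_s] := LTm_cancel ltmP fs hs; exists c => //.
apply: (sto_Nlt_trans (sto_olt ltmo)) lt_s.
have := Ssig_le (nf_preimage ltm F f - c%:MP *: nf_preimage ltm F h).
by rewrite vmapB vmapZ Ff Fh mul_mpolyC.
Qed.

(** * Minimality of S-irreducible elements *)

Section Irreducible.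
Variable lt : rel 'X_{1..n}.
Hypothesis ltP : term_order lt.

Let lto := to_order ltP.

(** Equal leading terms cancel after scaling h, so a smaller signature of h
    would make f reducible, with the power product t = 1. *)
Lemma S_irreducible_min f h :
  S_irreducible lt ltm F f -> in_ideal F h -> LT lt h = LT lt f ->
  ~~ olt ltm (Ssig ltm F h) (Ssig ltm F f).
Proof.
move=> [_ f0 irr_f] Ih hf; apply/negP => sig_lt; apply: irr_f.
have [t ft] := LT_Some lt f0; rewrite ft in hf *.
have [c c0 lt_t] := LT_cancel ltP ft hf.
exists h, 0%MM, c; rewrite mpolyX0 mul1r; split=> //.
by apply: contra_eq_neq hf => ->; rewrite /LT msupp0.
Qed.

(** Cancelling the common signature turns h into an element f - c h with the
    leading term of f and a smaller signature. *)
Lemma S_irreducible_LT_min f h :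
  S_irreducible lt ltm F f -> in_ideal F h ->
  Ssig ltm F h = Ssig ltm F f -> ~~ olt lt (LT lt h) (LT lt f).
Proof.
move=> irr_f Ih hf; have [If f0 _] := irr_f; apply/negP => lt_hf.
have [s fs] := Ssig_Some If f0; have [t ft] := LT_Some lt f0; rewrite fs in hf.
have [c _ lt_s] := Ssig_cancel If Ih fs hf.
have LT_f : LT lt (f - c *: h) = LT lt f.
  rewrite ft in lt_hf *; apply: (lead_dominate lto ft lt_hf (@msupp_subr _ _ _ _ _)).
  have [tf _] := (leadP lto _ _).1 ft.
  have th : t \notin msupp h := lead_lt_notin lto lt_hf.
  rewrite !mcoeff_msupp in tf th *; move: th => /negPn th.
  by rewrite mcoeffB mcoeffZ (eqP th) mulr0 subr0.
have := S_irreducible_min irr_f (in_idealB c If Ih) LT_f.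
by rewrite fs lt_s.
Qed.

End Irreducible.
End Signatures.

Theorem proposition14 (k : fieldType) (n m : nat)
    (lt : rel 'X_{1..n}) (ltm : rel (mterm n m))
    (lt_order : term_order lt) (ltm_order : mterm_order ltm)
    (lt_ltm : compatible_orders lt ltm)
    (F : 'rV[{mpoly k[n]}]_m)
    (G : {mpoly k[n]} -> Prop) (G_basis : S_Groebner_basis lt ltm F G) :
  exists G' : seq {mpoly k[n]},
    (forall g : {mpoly k[n]}, g \in G' -> G g) /\
    S_Groebner_basis lt ltm F (fun g : {mpoly k[n]} => g \in G').
Proof.
have [G_ideal G_irr] := G_basis.
pose T := ('X_{1..n} * mterm n m * ({mpoly k[n]} * 'X_{1..n}))%type.
pose coords : seq (T -> nat) :=
  [seq c \o (fun x : T => x.1.1) | c <- mnm_coords n] ++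
  [seq c \o (fun x : T => x.1.2) | c <- mterm_coords n m].
have [B [BP Bdiv]] := dickson coords (fun x : T =>
  [/\ G x.2.1, x.2.1 != 0, LT lt ('X_[x.2.2] * x.2.1) = Some x.1.1
    & Ssig ltm F ('X_[x.2.2] * x.2.1) = Some x.1.2]).
(* (a, b, (g, t)) in B records the multiple t g with LT a and signature b *)
exists [seq x.2.1 | x <- B].
have GB g : g \in [seq x.2.1 | x <- B] -> G g by move=> /mapP[x /BP[? _ _ _] ->].
split=> //; split=> [g /GB/G_ideal//|f irr_f]; have [If f0 _] := irr_f.
have [g [t [Gg g0 LTg Sg]]] := G_irr f irr_f.
have [tf ftf] := LT_Some lt f0; have [sf fsf] := Ssig_Some ltm_order If f0.
have [|[[a b] [g' t']] xB] := Bdiv (tf, sf, (g, t)).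
  by split; rewrite //= ?LTg ?Sg.
have [/= Gg' g'0 LTh Sh] := BP _ xB; have {}Gg' : g' \in [seq x.2.1 | x <- B].
  by apply/mapP; exists (a, b, (g', t')).
rewrite /divides_under all_cat => /andP[ba ba'].
move: ba ba'; rewrite -!/(divides_under _ _ _) !divides_under_comp /=.
move=> /mnm_coordsP[u tf_eq] /mterm_coordsP[w sf_eq].
have Ih : in_ideal F ('X_[t'] * g') by apply/in_idealM/G_ideal/GB.
have NSf : NS_Syz ltm F (mt_mul w b) by rewrite -sf_eq; apply: Ssig_NS fsf.
have Ixh v : in_ideal F ('X_[v] * ('X_[t'] * g')) by apply: in_idealM.
have [e|/(sto_total (to_order lt_order))/orP[uw|wu]] := eqVneq u w.
- exists g', (u + t')%MM; split=> //; rewrite mpolyXD -mulrA ?ftf ?fsf.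
    by rewrite (LT_mulX u lt_order LTh) tf_eq.
  by rewrite e (Ssig_mulX ltm_order Ih Sh NSf) sf_eq.
- have LTuh : LT lt ('X_[u] * ('X_[t'] * g')) = LT lt f.
    by rewrite (LT_mulX u lt_order LTh) ftf tf_eq.
  have /negP[] := S_irreducible_min lt_order irr_f (Ixh u) LTuh.
  apply: (sto_Nlt_trans (sto_olt (mto_order ltm_order))
            (Ssig_mulX_le ltm_order u Ih Sh)).
  rewrite fsf sf_eq /=; apply: lt_ltm.
  by rewrite ![(_ + b.1)%MM]addmC; apply: to_mul.
- have Swh : Ssig ltm F ('X_[w] * ('X_[t'] * g')) = Ssig ltm F f.
    by rewrite (Ssig_mulX ltm_order Ih Sh NSf) fsf sf_eq.
  have /negP[] := S_irreducible_LT_min ltm_order lt_order irr_f (Ixh w) Swh.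
  rewrite (LT_mulX w lt_order LTh) ftf tf_eq /=.
  by rewrite ![(_ + a)%MM]addmC; apply: to_mul.
Qed.
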